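(* Let $\mathcal{C}$ be a left skew-closed skew-monoidal category, with $L_X\dashv[X,-]$ for each object $X$, let $(T,m,u)$ be a monad on $\mathcal{C}$, and let $\mu_{\mathbf{1}}\colon T\mathbf{1}\to\mathbf{1}$ be such that $(\mathbf{1},\mu_{\mathbf{1}})\in\mathcal{C}^T$. Let $s_{X,Y}\colon T[TX,Y]\to[X,TY]$ be natural, and let $t_{X,Y}\colon L_YTX\to TL_{TY}X$ be its mate. Then: (1) $s$ satisfies $s_{X,Y}\circ u_{[TX,Y]}=[u_X,u_Y]$ for all $X,Y\in\mathcal C$ if and only if $t_{X,Y}\circ L_Yu_X=u_{L_{TY}X}\circ L_{u_Y}X$ for all $X,Y\in\mathcal{C}$. (2) $s$ satisfies $s_{X,Y}\circ m_{[TX,Y]}=[X,m_Y]\circ s_{X,TY}\circ Ts_{TX,Y}\circ T^2[m_X,Y]$ for all $X,Y\in\mathcal C$ if and only if $t_{X,Y}\circ L_Ym_X=T(L_{m_Y}X)\circ m_{L_{T^2Y}X}\circ Tt_{X,TY}\circ t_{TX,Y}$ for all $X,Y\in\mathcal{C}$. (3) $s$ satisfies $Ti_X=i_{TX}\circ s_{\mathbf{1},X}\circ T[\mu_{\mathbf{1}},X]$ for all $X\in\mathcal C$ if and only if $TL_{\mu_{\mathbf{1}}}X\circ t_{X,\mathbf{1}}\circ\rho_{TX}=T\rho_X$ for all $X\in\mathcal{C}$. (4) $s$ satisfies $j_M\circ\mu_{\mathbf{1}}=[M,\mu_M\circ m_M]\circ s_{M,TM}\circ Tj_{TM}$ for all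 $(M,\mu_M)\in\mathcal C^T$ if and only if $\lambda_M\circ L_M\mu_{\mathbf{1}}=\mu_M\circ m_M\circ T(\lambda_{TM})\circ t_{\mathbf{1},M}$ for all $(M,\mu_M)\in\mathcal{C}^T$. (5) $s$ satisfies $\Gamma^P_{X,TY}\circ s_{X,Y}=[[\mu_P,X],s_{P,Y}]\circ s_{[TP,X],[TP,Y]}\circ T[s_{P,X},[\mu_P,Y]]\circ T\Gamma^P_{TX,Y}$ for all $X,Y\in\mathcal C$ and $(P,\mu_P)\in\mathcal C^T$ if and only if $$t_{X,L_MY}\circ\alpha_{TX,Y,M}=T\Big(L_{T(L_{\mu_M^{(2)}}Y)}X\Big)\circ T\big(L_{t_{Y,TM}}X\big)\circ T\big(\alpha_{X,TY,TM}\big)\circ t_{L_{TY}X,M}\circ L_Mt_{X,Y}$$ for all $X,Y\in\mathcal{C}$ and all $(M,\mu_M)\in\mathcal{C}^T$, where $\mu_M^{(2)}=\mu_M\circ m_M=\mu_M\circ T\mu_M$.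
   Context: $\mathcal{C}^T$ is the Eilenberg–Moore category of $T$-algebras $(M,\mu_M)$. An object in a slot of a functor stands for its identity morphism. A (left) skew-closed category is a category $\mathcal{C}$ with an object $\mathbf{1}$, a functor $[-,-]\colon\mathcal{C}^{\mathrm{op}}\times\mathcal{C}\to\mathcal{C}$, a natural transformation $i_X\colon[\mathbf{1},X]\to X$, a dinatural transformation $j_X\colon\mathbf{1}\to[X,X]$, and morphisms $\Gamma^X_{Y,Z}\colon[Y,Z]\to[[X,Y],[X,Z]]$ natural in $Y,Z$ and dinatural in $X$, such that: $i_{\mathbf{1}}\circ j_{\mathbf{1}}=\mathrm{id}_{\mathbf 1}$; $i_{[X,Y]}\circ[j_X,[X,Y]]\circ\Gamma^X_{X,Y}=\mathrm{id}_{[X,Y]}$; $\Gamma^X_{Y,Y}\circ j_Y=j_{[X,Y]}$; $[[\mathbf{1},X],i_Y]\circ\Gamma^{\mathbf{1}}_{X,Y}=[i_X,Y]$; and $[\Gamma^U_{V,W},[[U,V],[U,X]]]\circ\Gamma^{[U,V]}_{[U,W],[U,X]}\circ\Gamma^U_{W,X}=[[V,W],\Gamma^U_{V,X}]\circ\Gamma^V_{W,X}$. Left skew-closed skew-monoidal means: $\mathcal{C}$ is left skew-closed, each $[X,-]$ has a left adjoint $L_X$ with unit $\mathrm{coev}^X$ and counit $\mathrm{ev}^X$, and $\mathcal{C}$ carries the corresponding left skew-monoidal structure $X\otimes Y:=L_YX$. Here $(X,Y)\mapsto L_XY$ is the unique bifunctor structure making the adjunction bijections natural in all three variables; for $f\colon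 X\to Y$, $L_fZ=\mathrm{ev}^X_{L_YZ}\circ L_X[f,L_YZ]\circ L_X\mathrm{coev}^Y_Z\colon L_XZ\to L_YZ$. The structure morphisms are: $\alpha_{X,Y,Z}\colon L_ZL_YX\to L_{L_ZY}X$, the unique morphism with $[Y,[Z,\alpha_{X,Y,Z}]]\circ[Y,\mathrm{coev}^Z_{L_YX}]\circ\mathrm{coev}^Y_X=[\mathrm{coev}^Z_Y,[Z,L_{L_ZY}X]]\circ\Gamma^Z_{L_ZY,L_{L_ZY}X}\circ\mathrm{coev}^{L_ZY}_X$; $\lambda_X\colon L_X\mathbf{1}\to X$, the unique morphism with $[X,\lambda_X]\circ\mathrm{coev}^X_{\mathbf{1}}=j_X$; and $\rho_X=i_{L_{\mathbf{1}}X}\circ\mathrm{coev}^{\mathbf{1}}_X\colon X\to L_{\mathbf{1}}X$. The mate of $s$ is the natural transformation $t_{X,Y}=\mathrm{ev}^Y_{T(L_{TY}X)}\circ L_Ys_{Y,L_{TY}X}\circ L_YT\mathrm{coev}^{TY}_X\colon L_YTX\to TL_{TY}X$. *)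

(* Defs.v *)
From Corelib Require Import ssreflect.

Set Implicit Arguments.
Unset Strict Implicit.
Unset Printing Implicit Defensive.

Declare Scope cat_scope.
Delimit Scope cat_scope with cat.
Local Open Scope cat_scope.

(* Categories are not assumed small or locally small; equality of morphisms is
   Leibniz equality. *)
Record category := Category {
  ob :> Type;
  hom : ob -> ob -> Type;
  idm : forall X, hom X X;
  comp : forall X Y Z, hom Y Z -> hom X Y -> hom X Z;
  comp1m : forall X Y (f : hom X Y), comp (idm Y) f = f;
  compm1 : forall X Y (f : hom X Y), comp f (idm X) = f;
  compA : forall W X Y Z (h : hom Y Z) (g : hom X Y) (f : hom W X),
    comp h (comp g f) = comp (comp h g) f
}.
Arguments hom {_} _ _.
Arguments idm {_} X.
Arguments comp {_ X Y Z} g f.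

Notation "X ~> Y" := (hom X Y) (at level 90, no associativity) : cat_scope.
Notation "g ∘ f" := (comp g f) (at level 40, left associativity) : cat_scope.

Definition opposite (C : category) : category :=
  @Category C (fun X Y => Y ~> X) (@idm C) (fun _ _ _ g f => f ∘ g)
    (fun _ _ f => compm1 f) (fun _ _ f => comp1m f)
    (fun _ _ _ _ h g f => eq_sym (compA f g h)).

Program Definition product (C D : category) : category :=
  @Category (C * D)%type
    (fun X Y => ((fst X ~> fst Y) * (snd X ~> snd Y))%type)
    (fun X => (idm (fst X), idm (snd X)))
    (fun _ _ _ g f => (fst g ∘ fst f, snd g ∘ snd f)) _ _ _.
Next Obligation. by move=> C D X Y [f1 f2] /=; rewrite !comp1m. Qed.
Next Obligation. by move=> C D X Y [f1 f2] /=; rewrite !compm1. Qed.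
Next Obligation. by move=> C D W X Y Z h g f /=; rewrite !compA. Qed.

Record functor (C D : category) := Functor {
  fob :> C -> D;
  fmap : forall X Y : C, X ~> Y -> fob X ~> fob Y;
  fmap_id : forall X : C, fmap (idm X) = idm (fob X);
  fmap_comp : forall (X Y Z : C) (g : Y ~> Z) (f : X ~> Y),
    fmap (g ∘ f) = fmap g ∘ fmap f
}.
Arguments fmap {C D} F {X Y} f : rename.

Record left_adjoint (C D : category) (G : functor D C) := LeftAdjoint {
  ladj : functor C D;
  unit_adj : forall Z : C, Z ~> G (ladj Z);
  counit_adj : forall W : D, ladj (G W) ~> W;
  unit_adj_nat : forall (Z Z' : C) (f : Z ~> Z'),
    unit_adj Z' ∘ f = fmap G (fmap ladj f) ∘ unit_adj Z;
  counit_adj_nat : forall (W W' : D) (g : W ~> W'),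
    counit_adj W' ∘ fmap ladj (fmap G g) = g ∘ counit_adj W;
  triangle_l : forall Z : C,
    counit_adj (ladj Z) ∘ fmap ladj (unit_adj Z) = idm (ladj Z);
  triangle_r : forall W : D,
    fmap G (counit_adj W) ∘ unit_adj (G W) = idm (G W)
}.

Record monad (C : category) := Monad {
  mfun :> functor C C;
  eta : forall X : C, X ~> mfun X;
  mu : forall X : C, mfun (mfun X) ~> mfun X;
  eta_nat : forall (X Y : C) (f : X ~> Y), eta Y ∘ f = fmap mfun f ∘ eta X;
  mu_nat : forall (X Y : C) (f : X ~> Y),
    mu Y ∘ fmap mfun (fmap mfun f) = fmap mfun f ∘ mu X;
  mu_eta : forall X : C, mu X ∘ eta (mfun X) = idm (mfun X);
  mu_fmap_eta : forall X : C, mu X ∘ fmap mfun (eta X) = idm (mfun X);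
  mu_mu : forall X : C, mu X ∘ mu (mfun X) = mu X ∘ fmap mfun (mu X)
}.

(* [(M, a)] is an object of the Eilenberg-Moore category of [T]. *)
Definition is_algebra (C : category) (T : monad C) (M : C) (a : T M ~> M) :
    Prop :=
  a ∘ eta T M = idm M /\ a ∘ mu T M = a ∘ fmap T a.

Record hom_category := HomCategory {
  hom_cat :> category;
  unit_ob : hom_cat;
  ihom_functor : functor (product (opposite hom_cat) hom_cat) hom_cat
}.

Definition ihom (C : hom_category) (X Y : C) : C := ihom_functor C (X, Y).

(* [imap f g] is the morphism [f,g], contravariant in [f]. *)
Definition imap (C : hom_category) (X X' Y Y' : C) (f : X ~> X') (g : Y ~> Y') :
    ihom X' Y ~> ihom X Y' :=
  @fmap _ _ (ihom_functor C) (X', Y) (X, Y') (f, g).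

Notation "⟦ X , Y ⟧" := (ihom X Y) (at level 0, X, Y at level 99) : cat_scope.

Record skew_closed := SkewClosed {
  sc_hom_cat :> hom_category;
  iota : forall X : sc_hom_cat, ⟦unit_ob sc_hom_cat, X⟧ ~> X;
  jota : forall X : sc_hom_cat, unit_ob sc_hom_cat ~> ⟦X, X⟧;
  Gam : forall X Y Z : sc_hom_cat, ⟦Y, Z⟧ ~> ⟦⟦X, Y⟧, ⟦X, Z⟧⟧;
  iota_nat : forall (X Y : sc_hom_cat) (f : X ~> Y),
    iota Y ∘ imap (idm (unit_ob sc_hom_cat)) f = f ∘ iota X;
  jota_dinat : forall (X Y : sc_hom_cat) (f : X ~> Y),
    imap (idm X) f ∘ jota X = imap f (idm Y) ∘ jota Y;
  Gam_nat : forall (X Y Y' Z Z' : sc_hom_cat) (g : Y ~> Y') (h : Z ~> Z'),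
    Gam X Y Z' ∘ imap g h
    = imap (imap (idm X) g) (imap (idm X) h) ∘ Gam X Y' Z;
  Gam_dinat : forall (X X' Y Z : sc_hom_cat) (f : X ~> X'),
    imap (imap f (idm Y)) (idm ⟦X, Z⟧) ∘ Gam X Y Z
    = imap (idm ⟦X', Y⟧) (imap f (idm Z)) ∘ Gam X' Y Z;
  iota_jota :
    iota (unit_ob sc_hom_cat) ∘ jota (unit_ob sc_hom_cat)
    = idm (unit_ob sc_hom_cat);
  iota_jota_Gam : forall X Y : sc_hom_cat,
    iota ⟦X, Y⟧ ∘ imap (jota X) (idm ⟦X, Y⟧) ∘ Gam X X Y = idm ⟦X, Y⟧;
  Gam_jota : forall X Y : sc_hom_cat, Gam X Y Y ∘ jota Y = jota ⟦X, Y⟧;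
  iota_Gam : forall X Y : sc_hom_cat,
    imap (idm ⟦unit_ob sc_hom_cat, X⟧) (iota Y) ∘ Gam (unit_ob sc_hom_cat) X Y
    = imap (iota X) (idm Y);
  Gam_Gam : forall U V W X : sc_hom_cat,
    imap (Gam U V W) (idm ⟦⟦U, V⟧, ⟦U, X⟧⟧)
      ∘ Gam ⟦U, V⟧ ⟦U, W⟧ ⟦U, X⟧ ∘ Gam U W X
    = imap (idm ⟦V, W⟧) (Gam U V X) ∘ Gam V W X
}.
Arguments iota {_} X.
Arguments jota {_} X.
Arguments Gam {_} X Y Z.

Program Definition ihom_from (C : hom_category) (X : C) : functor C C :=
  @Functor C C (fun Y => ⟦X, Y⟧) (fun _ _ g => imap (idm X) g) _ _.
Next Obligation. by move=> C X Y; exact: (fmap_id (ihom_functor C) (X, Y)). Qed.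
Next Obligation.
move=> C W X Y Z g f /=; rewrite -[in LHS](comp1m (idm W)).
exact: (@fmap_comp _ _ (ihom_functor C) (W, X) (W, Y) (W, Z)
          (idm W, g) (idm W, f)).
Qed.

Record skew_closed_monoidal := SkewClosedMonoidal {
  scm_closed :> skew_closed;
  ihom_ladj : forall X : scm_closed, left_adjoint (ihom_from X)
}.

Section SkewMonoidal.
Variable C : skew_closed_monoidal.
Implicit Types X Y Z : C.

Definition L X : functor C C := ladj (ihom_ladj X).
Definition coev X Z : Z ~> ⟦X, L X Z⟧ := unit_adj (ihom_ladj X) Z.
Definition ev X W : L X ⟦X, W⟧ ~> W := counit_adj (ihom_ladj X) W.

(* [Lmap f Z] is [L_f Z]; the functor [L_X] acts on morphisms by [fmap (L X)].
   Together they form the bifunctor [(Z, X) |-> L_X Z], i.e. the tensor. *)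
Definition Lmap X Y (f : X ~> Y) Z : L X Z ~> L Y Z :=
  ev X (L Y Z) ∘ fmap (L X) (imap f (idm (L Y Z))) ∘ fmap (L X) (coev Y Z).

Definition transpose X Z W (f : Z ~> ⟦X, W⟧) : L X Z ~> W :=
  ev X W ∘ fmap (L X) f.

Lemma transposeK X Z W (f : Z ~> ⟦X, W⟧) :
  imap (idm X) (transpose f) ∘ coev X Z = f.
Proof.
rewrite /transpose.
have := fmap_comp (ihom_from X) (ev X W) (fmap (L X) f); rewrite /= => ->.
rewrite -compA; have := unit_adj_nat (ihom_ladj X) f; rewrite /= => <-.
rewrite compA; have := triangle_r (ihom_ladj X) W; rewrite /= => ->.
exact: comp1m.
Qed.

Lemma transpose_uniq X Z W (f : Z ~> ⟦X, W⟧) (g : L X Z ~> W) :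
  imap (idm X) g ∘ coev X Z = f -> g = transpose f.
Proof.
rewrite /transpose => <-; rewrite fmap_comp compA.
have := counit_adj_nat (ihom_ladj X) g; rewrite /= => ->.
by rewrite -compA triangle_l compm1.
Qed.

Definition assoc X Y Z : L Z (L Y X) ~> L (L Z Y) X :=
  transpose (transpose
    (imap (coev Z Y) (idm ⟦Z, L (L Z Y) X⟧)
      ∘ Gam Z (L Z Y) (L (L Z Y) X) ∘ coev (L Z Y) X)).

Definition lunit X : L X (unit_ob C) ~> X := transpose (jota X).

Definition runit X : X ~> L (unit_ob C) X :=
  iota (L (unit_ob C) X) ∘ coev (unit_ob C) X.

Lemma Lmap_coev X Y (f : X ~> Y) Z :
  imap (idm X) (Lmap f Z) ∘ coev X Z = imap f (idm (L Y Z)) ∘ coev Y Z.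
Proof. by rewrite /Lmap -compA -fmap_comp transposeK. Qed.

Lemma assocP X Y Z :
  imap (idm Y) (imap (idm Z) (assoc X Y Z))
    ∘ imap (idm Y) (coev Z (L Y X)) ∘ coev Y X
  = imap (coev Z Y) (idm ⟦Z, L (L Z Y) X⟧)
      ∘ Gam Z (L Z Y) (L (L Z Y) X) ∘ coev (L Z Y) X.
Proof.
have := fmap_comp (ihom_from Y) (imap (idm Z) (assoc X Y Z)) (coev Z (L Y X)).
by rewrite /= => <-; rewrite /assoc !transposeK.
Qed.

Lemma assoc_uniq X Y Z (a : L Z (L Y X) ~> L (L Z Y) X) :
  imap (idm Y) (imap (idm Z) a) ∘ imap (idm Y) (coev Z (L Y X)) ∘ coev Y X
  = imap (coev Z Y) (idm ⟦Z, L (L Z Y) X⟧)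
      ∘ Gam Z (L Z Y) (L (L Z Y) X) ∘ coev (L Z Y) X ->
  a = assoc X Y Z.
Proof.
have := fmap_comp (ihom_from Y) (imap (idm Z) a) (coev Z (L Y X)).
rewrite /= => <- aE; apply: transpose_uniq; exact: transpose_uniq.
Qed.

Lemma lunitP X : imap (idm X) (lunit X) ∘ coev X (unit_ob C) = jota X.
Proof. exact: transposeK. Qed.

Lemma lunit_uniq X (l : L X (unit_ob C) ~> X) :
  imap (idm X) l ∘ coev X (unit_ob C) = jota X -> l = lunit X.
Proof. exact: transpose_uniq. Qed.

Definition mate (T : monad C) (s : forall X Y, T ⟦T X, Y⟧ ~> ⟦X, T Y⟧) X Y :
    L Y (T X) ~> T (L (T Y) X) :=
  ev Y (T (L (T Y) X)) ∘ fmap (L Y) (s Y (L (T Y) X))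
    ∘ fmap (L Y) (fmap T (coev (T Y) X)).

End SkewMonoidal.

(* Main.v *)
From Corelib Require Import ssreflect.
Require Import Defs.
Local Open Scope cat_scope.

(** Transposition along L_X ⊣ [X,-], sending f : L_X Z ~> W to
    curry f = [X,f] ∘ coev : Z ~> [X,W], is injective, and it turns each
    structure map of the skew-monoidal structure into one of the closed
    structure: α into Γ ([curry_assoc]), λ into j ([curry_lunit]), ρ into i
    ([comp_runit]), L_f into [f,-] ([curry_Lmap]), and the mate t into s:
    curry (T g ∘ t) = s ∘ T (curry g) for every g : L_{TY} X ~> W
    ([curry_mate]).

    Hence, if an equation between composites involving t is postcomposed with
    T g for an arbitrary g and then transposed, it becomes the corresponding
    equation for s, precomposed with T (curry g) (or with curry g or
    T (T (curry g)), according to how many times T is applied to [TX,Y] in the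
    equation).  The choice g = id recovers the equation for t, and g = ev,
    for which curry g = id, recovers the equation for s.  This one argument
    gives (1), (2) and (3), where in (3) composing with ρ takes the place
    of transposing.  In (4) each side of one equation is the transpose of the
    corresponding side of the other, with no parameter g.

    In (5) the morphisms are transposed twice, and the first argument X of
    the equation for s varies as well: the free parameters are
    g : L_{TV} X ~> W and h : L_M Y ~> V, and the equation for s appears
    between [curry h,-] and T (curry g).  The only further point is that μ_M
    occurs twice in the equation for s but (μ_M ∘ m_M) occurs once in the
    equation for t; dinaturality of Γ and naturality of s move the two copies
    of μ_M together, where they form μ_M ∘ T μ_M = μ_M ∘ m_M
    ([Gam_mate_rhsE]). *)

Set Implicit Arguments.
Unset Strict Implicit.
Unset Printing Implicit Defensive.

(** * Functoriality of the internal hom *)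

Section InternalHom.
Variable C : hom_category.
Implicit Types X Y Z : C.

Lemma imap_id X Y : imap (idm X) (idm Y) = idm ⟦X, Y⟧.
Proof. exact: (fmap_id (ihom_functor C) (X, Y)). Qed.

Lemma imap_comp X X' X'' Y Y' Y'' (f : X ~> X') (f' : X' ~> X'')
    (g : Y' ~> Y'') (g' : Y ~> Y') :
  imap f g ∘ imap f' g' = imap (f' ∘ f) (g ∘ g').
Proof.
symmetry.
exact: (@fmap_comp _ _ (ihom_functor C) (X'', Y) (X', Y') (X, Y'')
          (f, g) (f', g')).
Qed.

Lemma imap_compl X X' X'' Y (f : X ~> X') (f' : X' ~> X'') :
  imap (f' ∘ f) (idm Y) = imap f (idm Y) ∘ imap f' (idm Y).
Proof. by rewrite imap_comp comp1m. Qed.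

Lemma imap_compr X Y Y' Y'' (g : Y' ~> Y'') (g' : Y ~> Y') :
  imap (idm X) (g ∘ g') = imap (idm X) g ∘ imap (idm X) g'.
Proof. by rewrite imap_comp comp1m. Qed.

Lemma imap_lr X X' Y Y' (f : X ~> X') (g : Y ~> Y') :
  imap f (idm Y') ∘ imap (idm X') g = imap f g.
Proof. by rewrite imap_comp comp1m comp1m. Qed.

Lemma imap_rl X X' Y Y' (f : X ~> X') (g : Y ~> Y') :
  imap (idm X) g ∘ imap f (idm Y) = imap f g.
Proof. by rewrite imap_comp !compm1. Qed.

End InternalHom.

(** * Transposition, and the transposes of the structure maps *)

Section Curry.
Variable C : skew_closed_monoidal.
Implicit Types W X Y Z : C.

Definition curry X Z W (f : L X Z ~> W) : Z ~> ⟦X, W⟧ :=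
  imap (idm X) f ∘ coev X Z.

Lemma curry_inj X Z W (f g : L X Z ~> W) : curry f = curry g -> f = g.
Proof. by move=> /transpose_uniq ->; exact: eq_sym (transpose_uniq eq_refl). Qed.

Lemma curry_ev X W : curry (ev X W) = idm ⟦X, W⟧.
Proof. exact: (triangle_r (ihom_ladj X) W). Qed.

Lemma curry_comp X Z W W' (g : W ~> W') (f : L X Z ~> W) :
  curry (g ∘ f) = imap (idm X) g ∘ curry f.
Proof. by rewrite /curry imap_compr compA. Qed.

Lemma curry_fmapL X Z Z' W (f : L X Z' ~> W) (h : Z ~> Z') :
  curry (f ∘ fmap (L X) h) = curry f ∘ h.
Proof.
rewrite curry_comp /curry -compA; congr (_ ∘ _).
exact: eq_sym (unit_adj_nat (ihom_ladj X) h).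
Qed.

(** L_f is the mate of [f,-], so that precomposing with L_g is transposed into
    the contravariant action of g. *)
Lemma curry_Lmap X Y Z W (f : L Y Z ~> W) (g : X ~> Y) :
  curry (f ∘ Lmap g Z) = imap g (idm W) ∘ curry f.
Proof.
by rewrite curry_comp [in LHS]/curry Lmap_coev !compA imap_rl imap_lr.
Qed.

Lemma Lmap_id X Z : Lmap (idm X) Z = idm (L X Z).
Proof.
by apply: curry_inj; rewrite -[Lmap _ _]comp1m curry_Lmap imap_id comp1m.
Qed.

Lemma Gam_natl X Y Y' Z (g : Y ~> Y') :
  Gam X Y Z ∘ imap g (idm Z)
  = imap (imap (idm X) g) (idm ⟦X, Z⟧) ∘ Gam X Y' Z.
Proof. by rewrite Gam_nat imap_id. Qed.

Lemma Gam_natr X Y Z Z' (h : Z ~> Z') :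
  Gam X Y Z' ∘ imap (idm Y) h
  = imap (idm ⟦X, Y⟧) (imap (idm X) h) ∘ Gam X Y Z.
Proof. by rewrite Gam_nat imap_id. Qed.

(** Transposing twice gives the defining property of α; naturality of Γ in its
    last argument lets an arbitrary g follow α. *)
Lemma curry_assoc X Y Z W (g : L (L Z Y) X ~> W) :
  curry (curry (g ∘ assoc X Y Z))
  = imap (coev Z Y) (idm ⟦Z, W⟧) ∘ Gam Z (L Z Y) W ∘ curry g.
Proof.
have -> : curry (curry (g ∘ assoc X Y Z))
    = imap (idm Y) (imap (idm Z) g) ∘ curry (curry (assoc X Y Z)).
  by rewrite -curry_comp -curry_comp.
rewrite [curry (curry _)]/curry imap_compr assocP /curry.
by rewrite !compA -[in RHS](compA _ (Gam _ _ _)) Gam_natr compA imap_rl imap_lr.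
Qed.

Lemma curry_lunit X : curry (lunit X) = jota X.
Proof. exact: lunitP. Qed.

(** ρ enters without transposition, being defined by i and coev; naturality
    of i brings f inside. *)
Lemma comp_runit X W (f : L (unit_ob C) X ~> W) :
  f ∘ runit X = iota W ∘ curry f.
Proof. by rewrite /runit /curry compA -iota_nat compA. Qed.

(** * The mate of s *)

Section Mate.
Variables (T : monad C) (s : forall X Y : C, T ⟦T X, Y⟧ ~> ⟦X, T Y⟧).
Hypothesis s_nat : forall (X X' Y Y' : C) (f : X ~> X') (g : Y ~> Y'),
  s X Y' ∘ fmap T (imap (fmap T f) g) = imap f (fmap T g) ∘ s X' Y.

Lemma s_natl X X' Y (f : X ~> X') :
  s X Y ∘ fmap T (imap (fmap T f) (idm Y)) = imap f (idm (T Y)) ∘ s X' Y.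
Proof. by rewrite s_nat fmap_id. Qed.

Lemma s_natr X Y Y' (g : Y ~> Y') :
  s X Y' ∘ fmap T (imap (idm (T X)) g) = imap (idm X) (fmap T g) ∘ s X Y.
Proof. by rewrite -s_nat fmap_id. Qed.

(** This family of identities, one for each g, characterises the mate; it is
    the only property of t on which the equivalences rest. *)
Lemma curry_mate X Y W (g : L (T Y) X ~> W) :
  curry (fmap T g ∘ mate s X Y) = s Y W ∘ fmap T (curry g).
Proof.
rewrite curry_comp /mate curry_fmapL curry_fmapL curry_ev comp1m !compA.
by rewrite -s_natr -compA -fmap_comp.
Qed.

(** * Transposing the equations for t *)

Variable t : forall X Y : C, L Y (T X) ~> T (L (T Y) X).
Hypothesis curry_t : forall (X Y W : C) (g : L (T Y) X ~> W),
  curry (fmap T g ∘ t X Y) = s Y W ∘ fmap T (curry g).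

(** Both sides, followed by T g and transposed, are the two sides of the
    equation for s, preceded by curry g; naturality of the unit of T moves
    curry g to the right. *)
Lemma mate_unit_iff :
  (forall X Y : C, s X Y ∘ eta T ⟦T X, Y⟧ = imap (eta T X) (eta T Y))
  <->
  (forall X Y : C, t X Y ∘ fmap (L Y) (eta T X)
     = eta T (L (T Y) X) ∘ Lmap (eta T Y) X).
Proof.
have lhsE X Y W (g : L (T Y) X ~> W) :
    curry (fmap T g ∘ (t X Y ∘ fmap (L Y) (eta T X)))
    = s Y W ∘ eta T _ ∘ curry g.
  by rewrite compA curry_fmapL curry_t -!compA eta_nat.
have rhsE X Y W (g : L (T Y) X ~> W) :
    curry (fmap T g ∘ (eta T (L (T Y) X) ∘ Lmap (eta T Y) X))
    = imap (eta T Y) (eta T W) ∘ curry g.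
  by rewrite compA -eta_nat curry_Lmap curry_comp compA imap_lr.
split=> E X Y.
- rewrite -[LHS]comp1m -[RHS]comp1m -(fmap_id T).
  by apply: curry_inj; rewrite lhsE rhsE E.
- by rewrite -[LHS]compm1 -[RHS]compm1 -(curry_ev (T X) Y) -lhsE -rhsE E.
Qed.

(** The right-hand side contains t twice, hence [curry_t] is applied twice and
    curry g ends up under two copies of T. *)
Lemma mate_mult_iff :
  (forall X Y : C, s X Y ∘ mu T ⟦T X, Y⟧
     = imap (idm X) (mu T Y) ∘ s X (T Y) ∘ fmap T (s (T X) Y)
         ∘ fmap T (fmap T (imap (mu T X) (idm Y))))
  <->
  (forall X Y : C, t X Y ∘ fmap (L Y) (mu T X)
     = fmap T (Lmap (mu T Y) X) ∘ mu T (L (T (T Y)) X)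
         ∘ fmap T (t X (T Y)) ∘ t (T X) Y).
Proof.
have lhsE X Y W (g : L (T Y) X ~> W) :
    curry (fmap T g ∘ (t X Y ∘ fmap (L Y) (mu T X)))
    = s Y W ∘ mu T _ ∘ fmap T (fmap T (curry g)).
  by rewrite compA curry_fmapL curry_t -!compA mu_nat.
have rhsE X Y W (g : L (T Y) X ~> W) :
    curry (fmap T g ∘ (fmap T (Lmap (mu T Y) X) ∘ mu T (L (T (T Y)) X)
      ∘ fmap T (t X (T Y)) ∘ t (T X) Y))
    = imap (idm Y) (mu T W) ∘ s Y (T W) ∘ fmap T (s (T Y) W)
        ∘ fmap T (fmap T (imap (mu T Y) (idm W)))
        ∘ fmap T (fmap T (curry g)).
  rewrite !compA -fmap_comp -mu_nat -!compA (compA (fmap T (fmap T _))).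
  rewrite -fmap_comp curry_comp curry_t curry_t curry_Lmap.
  by rewrite !fmap_comp.
split=> E X Y.
- rewrite -[LHS]comp1m -[RHS]comp1m -(fmap_id T).
  by apply: curry_inj; rewrite lhsE rhsE E.
- have e : fmap T (fmap T (curry (ev (T X) Y))) = idm _.
    by rewrite curry_ev !fmap_id.
  by rewrite -[LHS]compm1 -[RHS]compm1 -e -lhsE -rhsE E.
Qed.

(** Composing with ρ already performs the transposition, so the two equations
    are compared after following them by T g, without [curry_inj]. *)
Lemma mate_runit_iff (mu1 : T (unit_ob C) ~> unit_ob C) :
  (forall X : C, fmap T (iota X)
     = iota (T X) ∘ s (unit_ob C) X ∘ fmap T (imap mu1 (idm X)))
  <->
  (forall X : C,
     fmap T (Lmap mu1 X) ∘ t X (unit_ob C) ∘ runit (T X)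
     = fmap T (runit X)).
Proof.
have lhsE X W (g : L (unit_ob C) X ~> W) :
    fmap T g ∘ (fmap T (Lmap mu1 X) ∘ t X (unit_ob C) ∘ runit (T X))
    = iota (T W) ∘ s (unit_ob C) W ∘ fmap T (imap mu1 (idm W))
        ∘ fmap T (curry g).
  rewrite 2!(compA (fmap T g)) -fmap_comp comp_runit curry_t curry_Lmap.
  by rewrite fmap_comp !compA.
have rhsE X W (g : L (unit_ob C) X ~> W) :
    fmap T g ∘ fmap T (runit X) = fmap T (iota W) ∘ fmap T (curry g).
  by rewrite -!fmap_comp comp_runit.
split=> E X.
- by rewrite -[LHS]comp1m -[RHS]comp1m -(fmap_id T) lhsE rhsE E.
- rewrite -[LHS]compm1 -[RHS]compm1 -(fmap_id T) -(curry_ev (unit_ob C) X).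
  by rewrite -lhsE -rhsE E.
Qed.

(** The two equations are transposes of each other as they stand, because λ is
    the transpose of j. *)
Lemma mate_lunit_iff (mu1 : T (unit_ob C) ~> unit_ob C) (M : C)
    (b : T (T M) ~> M) :
  jota M ∘ mu1 = imap (idm M) b ∘ s M (T M) ∘ fmap T (jota (T M))
  <->
  lunit M ∘ fmap (L M) mu1
  = b ∘ fmap T (lunit (T M)) ∘ t (unit_ob C) M.
Proof.
have lhsE : curry (lunit M ∘ fmap (L M) mu1) = jota M ∘ mu1.
  by rewrite curry_fmapL curry_lunit.
have rhsE : curry (b ∘ fmap T (lunit (T M)) ∘ t (unit_ob C) M)
    = imap (idm M) b ∘ s M (T M) ∘ fmap T (jota (T M)).
  by rewrite -compA curry_comp curry_t curry_lunit compA.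
by rewrite -lhsE -rhsE; split=> [/curry_inj|->].
Qed.

(** The outer a is moved inside by naturality of s, and the a in
    [-,[a,Y]] ∘ Γ^P is turned by dinaturality into [[a,TX],-] ∘ Γ^{TP}; naturality of s then gives the second a a
    factor T a, and the algebra law merges both into a ∘ mu.  In this form Γ
    has the index TP that the transpose of the α in the equation for t
    produces. *)
Lemma Gam_mate_rhsE X Y P (a : T P ~> P) (a_alg : is_algebra a) :
  imap (imap a (idm X)) (s P Y) ∘ s ⟦T P, X⟧ ⟦T P, Y⟧
    ∘ fmap T (imap (s P X) (imap a (idm Y))) ∘ fmap T (Gam P (T X) Y)
  = imap (idm ⟦P, X⟧) (s P Y) ∘ s ⟦P, X⟧ ⟦T P, Y⟧
    ∘ fmap T (imap (s (T P) X ∘ fmap T (imap (a ∘ mu T P) (idm X)))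
                (idm ⟦T P, Y⟧) ∘ Gam (T P) (T X) Y).
Proof.
rewrite -[imap (imap a _) (s P Y)]imap_rl -(compA (imap _ (s P Y))).
rewrite -s_natl -!compA -!fmap_comp; congr (_ ∘ (_ ∘ fmap T _)).
rewrite -(imap_lr (s P X)) -(compA (imap (s P X) _)) -Gam_dinat !compA.
by rewrite -!imap_compl compA -s_natl -compA -fmap_comp -imap_compl
           (proj2 a_alg).
Qed.

(** Besides g, the parameter h : L_M Y ~> V is needed because the transposed
    equation for t only involves s at objects L_M Y; precomposing with [h,-],
    which is the effect of L_{T h}, reaches every V through h = ev. *)
Lemma mate_assoc_iff M (a : T M ~> M) (a_alg : is_algebra a) :
  (forall X Y : C,
     Gam M X (T Y) ∘ s X Y
     = imap (imap a (idm X)) (s M Y) ∘ s ⟦T M, X⟧ ⟦T M, Y⟧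
         ∘ fmap T (imap (s M X) (imap a (idm Y)))
         ∘ fmap T (Gam M (T X) Y))
  <->
  (forall X Y : C,
     t X (L M Y) ∘ assoc (T X) Y M
     = fmap T (Lmap (fmap T (Lmap (a ∘ mu T M) Y)) X)
         ∘ fmap T (Lmap (t Y (T M)) X)
         ∘ fmap T (assoc X (T Y) (T M))
         ∘ t (L (T Y) X) M
         ∘ fmap (L M) (t X Y)).
Proof.
have lhsE X Y V W (g : L (T V) X ~> W) (h : L M Y ~> V) :
    curry (curry (fmap T (g ∘ Lmap (fmap T h) X)
      ∘ (t X (L M Y) ∘ assoc (T X) Y M)))
    = imap (curry h) (idm _) ∘ (Gam M V (T W) ∘ s V W) ∘ fmap T (curry g).
  rewrite compA curry_assoc curry_t curry_Lmap fmap_comp !compA.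
  rewrite -(compA _ (s _ _)) s_natl compA -(compA _ (Gam _ _ _)) Gam_natl.
  by rewrite compA -imap_compl.
have rhsE X Y V W (g : L (T V) X ~> W) (h : L M Y ~> V) :
    curry (curry (fmap T (g ∘ Lmap (fmap T h) X)
      ∘ (fmap T (Lmap (fmap T (Lmap (a ∘ mu T M) Y)) X)
         ∘ fmap T (Lmap (t Y (T M)) X)
         ∘ fmap T (assoc X (T Y) (T M))
         ∘ t (L (T Y) X) M
         ∘ fmap (L M) (t X Y))))
    = imap (curry h) (idm _)
        ∘ (imap (imap a (idm V)) (s M W) ∘ s ⟦T M, V⟧ ⟦T M, W⟧
            ∘ fmap T (imap (s M V) (imap a (idm W)))
            ∘ fmap T (Gam M (T V) W)) ∘ fmap T (curry g).
  rewrite Gam_mate_rhsE // 4!(compA (fmap T (g ∘ _))) -!(fmap_comp T).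
  rewrite curry_fmapL curry_t -compA curry_comp curry_t.
  (* All that lies under T transposes to a composite around Γ^{TM}: t Y (TM),
     followed by T (h ∘ Lmap (a ∘ mu)), transposes to s after T (curry h), and
     the contravariant slot puts curry h on the left. *)
  have -> : curry (curry (g ∘ Lmap (fmap T h) X
                ∘ Lmap (fmap T (Lmap (a ∘ mu T M) Y)) X
                ∘ Lmap (t Y (T M)) X ∘ assoc X (T Y) (T M)))
      = imap (fmap T (curry h)) (idm ⟦T M, W⟧)
        ∘ (imap (s (T M) V ∘ fmap T (imap (a ∘ mu T M) (idm V)))
             (idm ⟦T M, W⟧) ∘ Gam (T M) (T V) W ∘ curry g).
    rewrite curry_assoc !curry_Lmap; move: (curry g) => k.
    rewrite (compA (imap (t _ _) _)) (compA (imap (t _ _) _ ∘ _)).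
    rewrite -!imap_compl (compA (fmap T h)) -fmap_comp.
    rewrite compA -(compA _ (Gam _ _ _)) Gam_natl compA.
    rewrite -!imap_compl -[imap _ _ ∘ coev _ _]/(curry _) curry_t.
    by rewrite curry_Lmap fmap_comp !compA -imap_compl.
  rewrite fmap_comp (compA (s _ _)) s_natl !fmap_comp !compA.
  by rewrite imap_rl imap_lr.
split=> E X Y.
- rewrite -[LHS]comp1m -[RHS]comp1m -(fmap_id T) -(Lmap_id (T (L M Y)) X).
  (* g = id and h = id *)
  rewrite -(fmap_id T) -[Lmap _ _]comp1m.
  by do 2 apply: curry_inj; rewrite lhsE rhsE E.
- rewrite -[LHS]compm1 -[RHS]compm1 -(fmap_id T) -(curry_ev (T X) Y).
  rewrite -[LHS]comp1m -[RHS]comp1m -(imap_id ⟦M, X⟧) -(curry_ev M X) !compA.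
  by rewrite -(compA _ (Gam _ _ _)) -lhsE E rhsE !compA.
Qed.

End Mate.
End Curry.

(** * The five equivalences for s and its mate *)

Theorem proposition3p7
  (C : skew_closed_monoidal) (T : monad C)
  (mu1 : T (unit_ob C) ~> unit_ob C) (mu1_alg : is_algebra mu1)
  (s : forall X Y : C, T ⟦T X, Y⟧ ~> ⟦X, T Y⟧)
  (s_nat : forall (X X' Y Y' : C) (f : X ~> X') (g : Y ~> Y'),
    s X Y' ∘ fmap T (imap (fmap T f) g) = imap f (fmap T g) ∘ s X' Y) :
  let t := mate s in
  let mu2 (M : C) (a : T M ~> M) := a ∘ mu T M in
  (* (1) *)
  ((forall X Y : C, s X Y ∘ eta T ⟦T X, Y⟧ = imap (eta T X) (eta T Y))
   <->
   (forall X Y : C,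
      t X Y ∘ fmap (L Y) (eta T X) = eta T (L (T Y) X) ∘ Lmap (eta T Y) X))
  /\
  (* (2) *)
  ((forall X Y : C,
      s X Y ∘ mu T ⟦T X, Y⟧
      = imap (idm X) (mu T Y) ∘ s X (T Y) ∘ fmap T (s (T X) Y)
          ∘ fmap T (fmap T (imap (mu T X) (idm Y))))
   <->
   (forall X Y : C,
      t X Y ∘ fmap (L Y) (mu T X)
      = fmap T (Lmap (mu T Y) X) ∘ mu T (L (T (T Y)) X)
          ∘ fmap T (t X (T Y)) ∘ t (T X) Y))
  /\
  (* (3) *)
  ((forall X : C,
      fmap T (iota X)
      = iota (T X) ∘ s (unit_ob C) X ∘ fmap T (imap mu1 (idm X)))
   <->
   (forall X : C,
      fmap T (Lmap mu1 X) ∘ t X (unit_ob C) ∘ runit (T X)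
      = fmap T (runit X)))
  /\
  (* (4) *)
  ((forall (M : C) (a : T M ~> M), is_algebra a ->
      jota M ∘ mu1
      = imap (idm M) (a ∘ mu T M) ∘ s M (T M) ∘ fmap T (jota (T M)))
   <->
   (forall (M : C) (a : T M ~> M), is_algebra a ->
      lunit M ∘ fmap (L M) mu1
      = a ∘ mu T M ∘ fmap T (lunit (T M)) ∘ t (unit_ob C) M))
  /\
  (* (5) *)
  ((forall (X Y P : C) (a : T P ~> P), is_algebra a ->
      Gam P X (T Y) ∘ s X Y
      = imap (imap a (idm X)) (s P Y) ∘ s ⟦T P, X⟧ ⟦T P, Y⟧
          ∘ fmap T (imap (s P X) (imap a (idm Y)))
          ∘ fmap T (Gam P (T X) Y))
   <->
   (forall (X Y M : C) (a : T M ~> M), is_algebra a ->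
      t X (L M Y) ∘ assoc (T X) Y M
      = fmap T (Lmap (fmap T (Lmap (mu2 M a) Y)) X)
          ∘ fmap T (Lmap (t Y (T M)) X)
          ∘ fmap T (assoc X (T Y) (T M))
          ∘ t (L (T Y) X) M
          ∘ fmap (L M) (t X Y))).
Proof.
move=> t mu2; rewrite /t /mu2.
split; first exact: (mate_unit_iff (curry_mate s_nat)).
split; first exact: (mate_mult_iff (curry_mate s_nat)).
split; first exact: (mate_runit_iff (curry_mate s_nat)).
split.
  by split=> E M a aP;
    apply/(mate_lunit_iff (curry_mate s_nat) mu1 (a ∘ mu T M)); exact: E aP.
split=> E X Y M a aP; move: X Y.
  by apply/(mate_assoc_iff s_nat (curry_mate s_nat) aP) => X Y; exact: E.
by apply/(mate_assoc_iff s_nat (curry_mate s_nat) aP) => X Y; exact: E.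
Qed.
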